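(* Let $F$, $J$, $x_*$, $\gamma$, $\alpha$, $\delta_0$, $\alpha_c$ satisfy the standing assumptions and conventions of the context, and let $\bar\delta>0$ be such that, whenever $0<\|e_c\|\le\bar\delta$, the relations $\|s\|\le 2\|e_c\|$; $y=J_cs+\Delta_1s$ for a matrix $\Delta_1$ with $\|\Delta_1\|\le\gamma\|e_c\|$; and $\|y\|\ge\frac{1-\alpha_c\gamma\bar\delta}{\alpha_c}\|s\|$ hold. Then there is $\delta$ with $0<\delta\le\bar\delta$ such that for every current iterate $x_c$ with $0<\|e_c\|\le\delta$ and every symmetric positive definite $P_c\in\mathbb{R}^{n\times n}$ with $y^T(s-P_cy)>0$, setting $$P_+=P_c+\frac{(s-P_cy)(s-P_cy)^T}{y^T(s-P_cy)},\qquad \alpha_1=\|P_+\|,$$ one has $$P_+J_+s=s+w\qquad\text{with}\qquad \|w\|\le 6\,\alpha_1\,\gamma\,\delta^2 .$$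
   Context: Standing assumptions: $\Omega\subseteq\mathbb{R}^n$ is open and $F:\Omega\to\mathbb{R}^n$ is differentiable with Jacobian $J(x)$; $F(x)=0$ has a solution $x_*\in\Omega$; $J:\Omega\to\mathbb{R}^{n\times n}$ is Lipschitz continuous with constant $\gamma>0$; $J_*=J(x_* )$ is nonsingular and $\alpha=\|J_*^{-1}\|$. The Jacobians $J(x)$ are assumed symmetric positive definite. Norms are the Euclidean vector norm and its induced matrix norm. Notation: $x_c$ is the current iterate, $J_c=J(x_c)$, $F_c=F(x_c)$. The Newton step $s$ solves $J_cs=-F_c$, and the new iterate is $x_+=x_c+s$, with $J_+=J(x_+)$, $F_+=F(x_+)$. Set $y=F_+-F_c$, $e_c=x_*-x_c$. A number $0<\delta_0<\frac1{\alpha\gamma}$ is fixed and $\alpha_c=\frac{\alpha}{1-\alpha\gamma\delta_0}$; one has $\|J_c^{-1}\|\le\alpha_c$ when $\|e_c\|\le\delta_0$. *)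

(* Defs.v *)
From HB Require Import structures.
From mathcomp Require Export all_boot all_order all_algebra.
From mathcomp Require Export all_classical all_reals all_analysis.
Export Order.TTheory GRing.Theory Num.Theory.
Export numFieldNormedType.Exports.

Set Implicit Arguments.
Unset Strict Implicit.
Unset Printing Implicit Defensive.

Local Open Scope classical_set_scope.
Local Open Scope ring_scope.

(* The library norm on matrices is the max-norm, so the Euclidean norm and the
   norm it induces on matrices are defined here. The topology, hence openness
   and Frechet differentiability, does not depend on the choice of norm. *)
Definition norm2 (R : realType) (n : nat) (x : 'cV[R]_n) : R :=
  Num.sqrt (\sum_(i < n) x i 0 ^+ 2).

Definition opnorm2 (R : realType) (n : nat) (A : 'M[R]_n) : R :=
  sup [set norm2 (A *m x) | x in [set x : 'cV[R]_n | norm2 x <= 1]].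

Definition spd (R : realType) (n : nat) (A : 'M[R]_n) : Prop :=
  A^T = A /\ (forall x : 'cV[R]_n, x != 0 -> 0 < (x^T *m A *m x) 0 0).

(* Symmetric rank-one update of P; meaningful when the denominator
   y^T (s - P y) is nonzero. *)
Definition sr1_update (R : realType) (n : nat) (P : 'M[R]_n) (s y : 'cV[R]_n) :
    'M[R]_n :=
  P + ((y^T *m (s - P *m y)) 0 0)^-1 *: ((s - P *m y) *m (s - P *m y)^T).

(* Main.v *)
Require Import Defs.
From mathcomp Require Import ring lra.

(* The rank-one update satisfies the secant equation [P_+ y = s], so the error
   is [w = P_+ (J_+ s - y)].  Since [y = J_c s + D s], one has
   [J_+ s - y = (J_+ - J_c) s - D s], whose norm is at most
   [gamma |s|^2 + gamma |e| |s| <= 6 gamma |e|^2], with [e = x_* - x_c], because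
   [|s| <= 2 |e|].  The radius
   [delta] is such that [x_+], at distance at most [3 delta] from the solution,
   stays in the domain. *)

Local Open Scope classical_set_scope.
Local Open Scope ring_scope.

Section EuclideanNorm.
Set Implicit Arguments.
Unset Strict Implicit.
Variables (R : realType) (n : nat).
Implicit Types (x y : 'cV[R]_n) (A : 'M[R]_n) (a : R).

Lemma norm2_ge0 x : 0 <= norm2 x.
Proof. exact: sqrtr_ge0. Qed.

Lemma sqr_norm2 x : norm2 x ^+ 2 = \sum_(i < n) x i 0 ^+ 2.
Proof. by rewrite sqr_sqrtr// sumr_ge0// => i _; exact: sqr_ge0. Qed.

Lemma coord_le_norm2 x i : `|x i 0| <= norm2 x.
Proof.
rewrite -sqrtr_sqr ler_wsqrtr// (bigD1 i)//= lerDl.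
by rewrite sumr_ge0// => j _; exact: sqr_ge0.
Qed.

Lemma norm2_eq0 x : norm2 x = 0 -> x = 0.
Proof.
move=> x0; apply/matrixP => i j; rewrite ord1 mxE.
by apply/eqP; rewrite -normr_le0 -x0 coord_le_norm2.
Qed.

Lemma norm2_0 : norm2 (0 : 'cV[R]_n) = 0.
Proof. by rewrite /norm2 big1 ?sqrtr0// => i _; rewrite mxE expr0n. Qed.

Lemma norm2Z a x : norm2 (a *: x) = `|a| * norm2 x.
Proof.
rewrite /norm2 -sqrtr_sqr -sqrtrM ?sqr_ge0// mulr_sumr.
by congr Num.sqrt; apply: eq_bigr => i _; rewrite mxE exprMn.
Qed.

Lemma norm2N x : norm2 (- x) = norm2 x.
Proof. by rewrite -scaleN1r norm2Z normrN1 mul1r. Qed.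

(** With [a] and [b] the norms of nonzero [x] and [y], the nonnegative sum of the squares of
    [b * x i 0 - a * y i 0] expands to [2ab (ab - <x,y>)], and [2ab] is positive. *)
Lemma cauchy_schwarz x y : \sum_(i < n) x i 0 * y i 0 <= norm2 x * norm2 y.
Proof.
have [/norm2_eq0 ->|x0] := eqVneq (norm2 x) 0.
  by rewrite big1 ?mulr_ge0 ?norm2_ge0// => i _; rewrite mxE mul0r.
have [/norm2_eq0 ->|y0] := eqVneq (norm2 y) 0.
  by rewrite big1 ?mulr_ge0 ?norm2_ge0// => i _; rewrite mxE mulr0.
set a := norm2 x in x0 *; set b := norm2 y in y0 *.
have a_gt0 : 0 < a by rewrite lt_neqAle eq_sym x0 norm2_ge0.
have b_gt0 : 0 < b by rewrite lt_neqAle eq_sym y0 norm2_ge0.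
have : 0 <= \sum_(i < n) (b * x i 0 - a * y i 0) ^+ 2.
  by apply: sumr_ge0 => i _; exact: sqr_ge0.
have sqE i : (b * x i 0 - a * y i 0) ^+ 2 = b ^+ 2 * x i 0 ^+ 2
    + a ^+ 2 * y i 0 ^+ 2 - (2 * (a * b)) * (x i 0 * y i 0) by ring.
under eq_bigr => i _ do rewrite sqE.
rewrite sumrB big_split/= -!mulr_sumr -!sqr_norm2 -/a -/b subr_ge0.
rewrite (_ : _ + _ = 2 * (a * b) * (a * b)); last by ring.
by rewrite ler_pM2l// !mulr_gt0.
Qed.

Lemma norm2D x y : norm2 (x + y) <= norm2 x + norm2 y.
Proof.
rewrite -(ler_pXn2r (ltn0Sn 1)) ?nnegrE ?addr_ge0 ?norm2_ge0//.
rewrite sqrrD !sqr_norm2.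
under eq_bigr => i _ do rewrite mxE sqrrD.
rewrite !big_split/= lerD2r lerD2l.
by rewrite !mulr2n lerD ?cauchy_schwarz.
Qed.

(** Makes the [sup] in [opnorm2] a genuine supremum. On the unit ball every coordinate of [x] is at
    most 1 in absolute value, so each coordinate of [A *m x] is bounded by the absolute sum of its
    row. *)
Lemma has_sup_opnorm2 A :
  has_sup [set norm2 (A *m x) | x in [set x : 'cV[R]_n | norm2 x <= 1]].
Proof.
split; first by exists (norm2 (A *m 0)), 0 => //=; rewrite norm2_0.
exists (Num.sqrt (\sum_(i < n) (\sum_(j < n) `|A i j|) ^+ 2)) => _ [x /= x1 <-].
apply: ler_wsqrtr; apply: ler_sum => i _.
rewrite mxE -real_normK ?num_real//.
rewrite ler_pXn2r ?nnegrE ?sumr_ge0//.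
apply: le_trans (ler_norm_sum _ _ _) _; apply: ler_sum => j _.
by rewrite normrM ler_piMr// (le_trans (coord_le_norm2 _ _)).
Qed.

Lemma opnorm2_ge0 A : 0 <= opnorm2 A.
Proof.
apply: le_trans (norm2_ge0 (A *m 0)) _; apply: sup_ubound.
  by case: (has_sup_opnorm2 A).
by exists 0 => //=; rewrite norm2_0.
Qed.

Lemma norm2_mulmx A x : norm2 (A *m x) <= opnorm2 A * norm2 x.
Proof.
have [/norm2_eq0 ->|x0] := eqVneq (norm2 x) 0.
  by rewrite mulmx0 norm2_0 mulr0.
have x_gt0 : 0 < norm2 x by rewrite lt_neqAle eq_sym x0 norm2_ge0.
rewrite -ler_pdivrMr// mulrC -[(norm2 x)^-1]ger0_norm ?invr_ge0 ?norm2_ge0//.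
rewrite -norm2Z scalemxAr; apply: sup_ubound.
  by case: (has_sup_opnorm2 A).
exists ((norm2 x)^-1 *: x) => //=.
by rewrite norm2Z ger0_norm ?invr_ge0 ?norm2_ge0// mulVf.
Qed.

(** Balls of the ambient topology are entrywise; a Euclidean ball lies inside the entrywise ball of
    the same radius. *)
Lemma open_norm2_ball (U : set 'cV[R]_n) x : open U -> U x ->
  exists2 r : R, 0 < r & forall y, norm2 (x - y) < r -> U y.
Proof.
move=> oU Ux; have /nbhs_ballP[r /= r0 rU] := open_nbhs_nbhs (conj oU Ux).
exists r => // y xy; apply: rU; split => // i j.
rewrite ord1; apply: le_lt_trans xy.
by have := coord_le_norm2 (x - y) i; rewrite !mxE.
Qed.

(** With [u = s - P y], the rank-one term sends [y] to [u (u^T y) / (y^T u) = u], and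
    [P y + u = s]. *)
Lemma sr1_update_secant (P : 'M[R]_n) (s y : 'cV[R]_n) :
  (y^T *m (s - P *m y)) 0 0 != 0 -> sr1_update P s y *m y = s.
Proof.
rewrite /sr1_update; set u := s - P *m y => u0.
have uyE : u^T *m y = ((y^T *m u) 0 0)%:M.
  by rewrite -tr_scalar_mx -mx11_scalar trmx_mul trmxK.
rewrite mulmxDl -scalemxAl -mulmxA uyE mul_mx_scalar scalerA mulVf// scale1r.
by rewrite /u addrC subrK.
Qed.

End EuclideanNorm.

Theorem theorem3p3 (R : realType) (n : nat) (Omega : set 'cV[R]_n)
    (F : 'cV[R]_n -> 'cV[R]_n) (J : 'cV[R]_n -> 'M[R]_n) (xs : 'cV[R]_n)
    (gamma alpha delta0 alphac dbar : R)
    (hOmega : open Omega)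
    (hJ : forall x, Omega x -> is_diff x F (fun h : 'cV[R]_n => J x *m h))
    (hxs : Omega xs) (hFxs : F xs = 0)
    (hgamma : 0 < gamma)
    (hlip : forall x y, Omega x -> Omega y ->
      opnorm2 (J x - J y) <= gamma * norm2 (x - y))
    (hspd : forall x, Omega x -> spd (J x))
    (hunit : J xs \in unitmx)
    (halpha : alpha = opnorm2 (invmx (J xs)))
    (hdelta0 : 0 < delta0 < 1 / (alpha * gamma))
    (halphac : alphac = alpha / (1 - alpha * gamma * delta0))
    (hdbar : 0 < dbar)
    (hrel : forall xc s : 'cV[R]_n, Omega xc ->
      0 < norm2 (xs - xc) <= dbar -> J xc *m s = - F xc ->
      norm2 s <= 2 * norm2 (xs - xc) /\
      (Omega (xc + s) ->
        let y := F (xc + s) - F xc in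
        (exists2 Delta1 : 'M[R]_n,
           y = J xc *m s + Delta1 *m s
           & opnorm2 Delta1 <= gamma * norm2 (xs - xc)) /\
        (1 - alphac * gamma * dbar) / alphac * norm2 s <= norm2 y)) :
  exists2 delta : R, 0 < delta <= dbar &
    forall xc : 'cV[R]_n, 0 < norm2 (xs - xc) <= delta ->
      Omega xc /\
      forall s : 'cV[R]_n, J xc *m s = - F xc ->
        Omega (xc + s) /\
        forall P : 'M[R]_n, spd P ->
          let y := F (xc + s) - F xc in
          0 < (y^T *m (s - P *m y)) 0 0 ->
          let Pp := sr1_update P s y in
          let alpha1 := opnorm2 Pp in
          exists2 w : 'cV[R]_n,
            Pp *m J (xc + s) *m s = s + w
            & norm2 w <= 6 * alpha1 * gamma * delta ^+ 2.
Proof.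
have [r r0 rOmega] := open_norm2_ball hOmega hxs.
(* The factor 4 makes [3 * delta < r] strict, as the open ball of radius [r] requires. *)
exists (Num.min dbar (r / 4)); first by rewrite lt_min hdbar divr_gt0//= ge_min lexx.
set delta := Num.min _ _ => xc /andP[e0 ed].
have er : norm2 (xs - xc) <= r / 4 by rewrite (le_trans ed)// ge_min lexx orbT.
have edbar : 0 < norm2 (xs - xc) <= dbar.
  by rewrite e0 (le_trans ed)// ge_min lexx.
have Oxc : Omega xc by apply: rOmega; lra.
split=> // s hs.
have [s2e hy] := hrel xc s Oxc edbar hs.
have Oxp : Omega (xc + s).
  (* Here [x_* - x_+ = e - s] has norm at most [|e| + 2|e| <= 3r/4]. *)
  apply: rOmega; rewrite opprD addrA; apply: le_lt_trans (norm2D _ _) _.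
  rewrite norm2N; lra.
split=> // P _ y ypos Pp alpha1.
have [[D yE Dle] _] := hy Oxp.
(* The secant equation turns [Pp *m y] into [s], so this is [P_+ J_+ s - s]. *)
exists (Pp *m (J (xc + s) *m s - y)).
  rewrite mulmxBr -mulmxA sr1_update_secant ?gt_eqF//.
  by rewrite [RHS]addrC subrK.
have -> : J (xc + s) *m s - y = (J (xc + s) - J xc) *m s - D *m s.
  by rewrite /y yE opprD addrA mulmxBl.
apply: le_trans (norm2_mulmx _ _) _; rewrite -/alpha1.
rewrite [6 * _]mulrC -!mulrA ler_wpM2l ?opnorm2_ge0//.
apply: le_trans (norm2D _ _) _; rewrite norm2N.
set e := norm2 (xs - xc) in e0 ed er edbar s2e Dle *.
have sge0 := norm2_ge0 s.
(* The Lipschitz bound applies with [x_+ - x_c = s]. *)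
have h1 : norm2 ((J (xc + s) - J xc) *m s) <= gamma * norm2 s * norm2 s.
  apply: le_trans (norm2_mulmx _ _) _; rewrite ler_wpM2r//.
  by have := hlip _ _ Oxp Oxc; rewrite [xc + s]addrC addrK.
have h2 : norm2 (D *m s) <= gamma * e * norm2 s.
  by apply: le_trans (norm2_mulmx _ _) _; rewrite ler_wpM2r.
apply: le_trans (lerD h1 h2) _.
(* After cancelling [gamma]: [|s|^2 + e|s| <= 4e^2 + 2e^2 <= 6 delta^2]. *)
rewrite -!mulrA -mulrDr mulrCA ler_pM2l//; nra.
Qed.
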